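(* Let $G$ be a connected $(P_7,C_7,C_4,\text{gem})$-free graph. Then at least one of the following holds: $G$ has a clique-cutset; $G$ has a bisimplicial vertex; $G$ is a blowup of the Petersen graph.
   Context: All graphs are finite and simple. $P_\ell$ and $C_\ell$ denote the chordless path and chordless cycle on $\ell$ vertices. The gem is the graph consisting of a $P_4$ together with a vertex adjacent to all four vertices of the $P_4$. A graph is $(L_1,L_2,\ldots)$-free if it has no induced subgraph isomorphic to any $L_i$. A clique-cutset of $G$ is a clique $K$ in $G$ such that $G\setminus K$ has more connected components than $G$. A vertex is bisimplicial if its neighborhood is the union of two cliques (not necessarily disjoint, possibly empty). A blowup of a graph $H$ with vertices $v_1,\dots,v_n$ is any graph whose vertex set can be partitioned into $n$ (not necessarily non-empty) cliques $A_1,\dots,A_n$ such that every vertex of $A_i$ is adjacent to every vertex of $A_j$ if $v_iv_j\in E(H)$, and there are no edges between $A_i$ and $A_j$ if $i\neq j$ and $v_iv_j\notin E(H)$. *)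

(* Defs.v *)
From mathcomp Require Import all_boot.

Set Implicit Arguments.
Unset Strict Implicit.
Unset Printing Implicit Defensive.

Record sgraph := SGraph {
  vertex :> finType;
  adj : rel vertex;
  adj_sym : symmetric adj;
  adj_irrefl : irreflexive adj }.
Arguments adj {s} x y.

Section Induced.
Variables (G : sgraph) (A : {set G}).

Definition induced_adj : rel {x : G | x \in A} :=
  fun x y => adj (val x) (val y).

Lemma induced_sym : symmetric induced_adj.
Proof. by move=> x y; rewrite /induced_adj adj_sym. Qed.

Lemma induced_irrefl : irreflexive induced_adj.
Proof. by move=> x; rewrite /induced_adj adj_irrefl. Qed.

Definition induced : sgraph := SGraph induced_sym induced_irrefl.
End Induced.

Definition isomorphic (G H : sgraph) : Prop :=
  exists2 f : G -> H, bijective f & forall x y, adj (f x) (f y) = adj x y.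

Definition free_of (L G : sgraph) : Prop :=
  forall A : {set G}, ~ isomorphic (induced A) L.

Definition path_adj l : rel 'I_l := fun i j => (i.+1 == j) || (j.+1 == i).

Lemma path_sym l : symmetric (@path_adj l).
Proof. by move=> i j; rewrite /path_adj orbC. Qed.

Lemma path_irrefl l : irreflexive (@path_adj l).
Proof. by move=> i; rewrite /path_adj orbb gtn_eqF. Qed.

Definition path_graph l : sgraph := SGraph (@path_sym l) (@path_irrefl l).

(* The conjunct [i != j] only matters for the degenerate case l = 1. *)
Definition cycle_adj l : rel 'I_l :=
  fun i j => (i != j) && ((ordS i == j) || (ordS j == i)).

Lemma cycle_sym l : symmetric (@cycle_adj l).
Proof. by move=> i j; rewrite /cycle_adj eq_sym orbC. Qed.

Lemma cycle_irrefl l : irreflexive (@cycle_adj l).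
Proof. by move=> i; rewrite /cycle_adj eqxx. Qed.

Definition cycle_graph l : sgraph := SGraph (@cycle_sym l) (@cycle_irrefl l).

(* [Some i] are the vertices of the P_4, [None] is the vertex adjacent to all
   of them. *)
Definition gem_adj : rel (option 'I_4) := fun x y =>
  match x, y with
  | Some i, Some j => path_adj i j
  | None, None => false
  | _, _ => true
  end.

Lemma gem_sym : symmetric gem_adj.
Proof. by move=> [i|] [j|] //=; rewrite path_sym. Qed.

Lemma gem_irrefl : irreflexive gem_adj.
Proof. by move=> [i|] //=; rewrite path_irrefl. Qed.

Definition gem : sgraph := SGraph gem_sym gem_irrefl.

(* The Petersen graph as the Kneser graph K(5,2). *)
Definition petersen_adj : rel {A : {set 'I_5} | #|A| == 2} :=
  fun A B => [disjoint val A & val B].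

Lemma petersen_sym : symmetric petersen_adj.
Proof. by move=> A B; rewrite /petersen_adj disjoint_sym. Qed.

Lemma petersen_irrefl : irreflexive petersen_adj.
Proof.
move=> [A /= cA]; rewrite /petersen_adj /= -setI_eq0 setIid.
by apply: contraTF cA => /eqP->; rewrite cards0.
Qed.

Definition petersen : sgraph := SGraph petersen_sym petersen_irrefl.

Definition connected_graph (G : sgraph) : Prop :=
  forall x y : G, connect adj x y.

Definition num_components (G : sgraph) : nat := n_comp (@adj G) predT.

Definition neighborhood (G : sgraph) (v : G) : {set G} := [set w | adj v w].

Definition is_clique (G : sgraph) (K : {set G}) : Prop :=
  {in K &, forall x y, x != y -> adj x y}.

Definition clique_cutset (G : sgraph) (K : {set G}) : Prop :=
  is_clique K /\ num_components G < num_components (induced (~: K)).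

Definition bisimplicial (G : sgraph) (v : G) : Prop :=
  exists K1 K2 : {set G},
    [/\ is_clique K1, is_clique K2 & neighborhood v = K1 :|: K2].

Definition is_blowup (G H : sgraph) : Prop :=
  exists A : H -> {set G},
    [/\ \bigcup_i A i = [set: G],
        forall i j, i != j -> [disjoint A i & A j],
        forall i, is_clique (A i),
        forall i j, adj i j -> {in A i & A j, forall x y, adj x y}
      & forall i j, i != j -> ~~ adj i j ->
          {in A i & A j, forall x y, ~~ adj x y}].

(* Main.v *)
(* Suppose that no vertex is bisimplicial. In a (C_4, gem)-free graph every
   neighborhood N(u) is (P_4, C_4)-free; call an edge uw good if
   N(u) :&: N(w) is a clique. If S is a set of at most two good neighbors of u,
   then N(u) is not covered by the two cliques N(u) :&: N[a], a in S, and a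
   vertex w of N(u) outside them with minimal N(u) :&: N[w] is again a good
   neighbor of u. So every vertex has three pairwise nonadjacent good neighbors,
   and one can grow a tree of good edges from any vertex. The subgraph induced by
   this tree runs into a forbidden subgraph or the Petersen graph before it has 15
   vertices; this finite search is done by computation.

   Fix an induced Petersen graph P. Again by computation, a vertex outside P is
   adjacent to a clique of P or to the closed neighborhood of one vertex, and
   the vertices of the second kind form with P a blowup Q of the Petersen graph.
   Two adjacent vertices outside Q have the same neighbors in P, hence (replacing
   vertices of P by clones) the same neighbors in Q, and these form a clique.
   So a vertex outside Q yields a clique-cutset. *)
Require Import Defs.
From mathcomp Require Import all_boot zify.

Set Implicit Arguments.
Unset Strict Implicit.
Unset Printing Implicit Defensive.

(** * Coding of finite graphs by triangular matrices *)

(* A graph on a list of vertices is coded by its strictly lower triangular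
   adjacency matrix; index 0 is the head of the list, i.e. the vertex that was
   added last. *)
Section Code.
Variables (T : Type) (e : rel T).

Fixpoint code (x : seq T) : seq (seq bool) :=
  if x is y :: x' then [seq e y z | z <- x'] :: code x' else [::].

Lemma size_code x : size (code x) = size x.
Proof. by elim: x => //= y x ->. Qed.
End Code.

(** For i < j the bit sits in row i at position j - i - 1, because row i starts with the pair (i, i
    + 1). The diagonal and everything out of range read as [false]. *)
Fixpoint edge (M : seq (seq bool)) (i j : nat) : bool :=
  match M, i, j with
  | r :: _, 0, j'.+1 => nth false r j'
  | r :: _, i'.+1, 0 => nth false r i'
  | _ :: M', i'.+1, j'.+1 => edge M' i' j'
  | _, _, _ => false
  end.

Lemma edgeC M i j : edge M i j = edge M j i.
Proof. by elim: M i j => [|r M IH] [|i] [|j] /=. Qed.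

Lemma edge_irrefl M i : edge M i i = false.
Proof. by elim: M i => [|r M IH] [|i] /=. Qed.

Lemma edge_code (T : Type) (e : rel T) v x i j :
  symmetric e -> i < size x -> j < size x -> i != j ->
  edge (code e x) i j = e (nth v x i) (nth v x j).
Proof.
move=> eC; elim: x i j => [|y x IH] [|i] [|j] //= lti ltj neij.
- by rewrite (nth_map v).
- by rewrite (nth_map v) // eC.
- exact: IH.
Qed.

Lemma eq_code (T T' : Type) (e : rel T) (e' : rel T') v v' x x' :
  size x = size x' ->
  (forall i j, i < j < size x ->
     e (nth v x i) (nth v x j) = e' (nth v' x' i) (nth v' x' j)) ->
  code e x = code e' x'.
Proof.
elim: x x' => [|y x IH] [|y' x'] //= [eq_sz] eq_e; congr (_ :: _).
  apply: (@eq_from_nth _ false) => [|i]; rewrite !size_map // => lti.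
  rewrite (nth_map v) // (nth_map v') -?eq_sz //.
  exact: (eq_e 0 i.+1).
by apply: IH => // i j ij; apply: (eq_e i.+1 j.+1).
Qed.

(** * Forbidden induced subgraphs, on explicit vertices *)

Section InducedCopies.
Variable G : sgraph.

Lemma induced_copy (L : sgraph) (f : L -> G) :
  injective f -> (forall a b, adj (f a) (f b) = adj a b) -> ~ free_of L G.
Proof.
move=> f_inj f_adj /(_ [set a in codom f]); apply.
have in_codom (u : {a : G | a \in [set a in codom f]}) : val u \in codom f.
  by have := valP u; rewrite inE.
have in_image a : f a \in [set a in codom f] by rewrite inE codom_f.
exists (fun u : induced _ => iinv (in_codom u)).
  exists (fun a => exist _ (f a) (in_image a)) => [u|a].
    by apply: val_inj; rewrite /= f_iinv.
  by apply: f_inj; rewrite f_iinv.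
by move=> u w; rewrite -f_adj !f_iinv.
Qed.

Lemma no_square (a b c d : G) :
  free_of (cycle_graph 4) G -> a != c -> b != d ->
  adj a b -> adj b c -> adj c d -> adj d a -> ~~ adj a c -> adj b d.
Proof.
move=> hC4 ac bd ab bc cd da nac; apply/negP => /negP nbd.
pose f (i : 'I_4) := nth a [:: a; b; c; d] i.
have uq : uniq [:: a; b; c; d].
  have neq (y z : G) : adj y z -> y != z.
    by apply: contraTneq => ->; rewrite adj_irrefl.
  by rewrite /= !inE !negb_or ac bd (neq _ _ ab) (neq _ _ bc) (neq _ _ cd)
    eq_sym (neq _ _ da).
apply: (@induced_copy (cycle_graph 4) f) hC4.
  move=> i j /eqP; rewrite nth_uniq //; try exact: ltn_ord.
  by move/eqP/val_inj.
have S := @adj_sym G; have I := @adj_irrefl G.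
by case=> [[|[|[|[|]]]] // ?] [[|[|[|[|]]]] // ?];
  rewrite /f /= ?I ?ab ?bc ?cd ?da ?(negPf nac) ?(negPf nbd) //
    S ?ab ?bc ?cd ?da ?(negPf nac) ?(negPf nbd).
Qed.

Lemma no_gem (u a b c d : G) :
  free_of gem G -> adj u a -> adj u b -> adj u c -> adj u d ->
  adj a b -> adj b c -> adj c d -> ~~ adj a c -> ~~ adj b d -> adj a d.
Proof.
move=> hgem ua ub uc ud ab bc cd nac nbd; apply/negP => /negP nad.
pose f (i : option 'I_4) := if i is Some i then nth a [:: a; b; c; d] i else u.
have S := @adj_sym G; have I := @adj_irrefl G.
have adjf i j : adj (f i) (f j) = gem_adj i j.
  by case: i j => [[[|[|[|[|]]]] // ?]|] [[[|[|[|[|]]]] // ?]|];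
    rewrite /f /= ?I ?ab ?bc ?cd ?ua ?ub ?uc ?ud ?(negPf nac) ?(negPf nbd)
      ?(negPf nad) // S ?ab ?bc ?cd ?ua ?ub ?uc ?ud ?(negPf nac) ?(negPf nbd)
      ?(negPf nad).
apply: (@induced_copy gem f) hgem => // i j eqf.
(* Distinct vertices of the gem have distinct neighborhoods, so the adjacencies alone make [f]
   injective. *)
have : gem_adj i =1 gem_adj j by move=> k; rewrite -!adjf eqf.
case: i j {eqf} => [[[|[|[|[|]]]] // ?]|] [[[|[|[|[|]]]] // ?]|] eqf;
  try (by congr Some; apply: val_inj); try done;
  by move: (eqf None) (eqf (Some (@Ordinal 4 0 isT)))
    (eqf (Some (@Ordinal 4 1 isT))) (eqf (Some (@Ordinal 4 2 isT)))
    (eqf (Some (@Ordinal 4 3 isT))).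
Qed.
End InducedCopies.

(* The end points of a sequence of length 7 may or may not be adjacent, so that
   such a sequence is an induced P_7 or an induced C_7. *)
Definition chordless (T : Type) (e : rel T) v p :=
  forall i j, i < j < size p -> (i, j) != (0, 6) ->
    e (nth v p i) (nth v p j) = (j == i.+1).

Lemma no_chordless7 (G : sgraph) (v : G) q :
  free_of (path_graph 7) G -> free_of (cycle_graph 7) G ->
  size q = 7 -> uniq q -> ~ chordless adj v q.
Proof.
move=> hP7 hC7 sq uq chq.
pose f (i : 'I_7) := nth v q i.
have f_inj : injective f.
  move=> i j /eqP; rewrite nth_uniq ?sq //; try exact: ltn_ord.
  by move/eqP/val_inj.
have adjf (e : rel 'I_7) : symmetric e -> irreflexive e ->
    (forall i j : 'I_7, i < j -> e i j =
       if (val i, val j) == (0, 6) then adj (nth v q 0) (nth v q 6)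
       else j == i.+1 :> nat) ->
    forall i j, adj (f i) (f j) = e i j.
  move=> eC eI eE.
  have lt_adj (i j : 'I_7) : i < j -> adj (f i) (f j) = e i j.
    move=> ltij; rewrite eE //; case: eqP => [[/= i0 j6]|/eqP ne].
      by rewrite /f i0 j6.
    by apply: chq; rewrite ?sq ?ltij /=.
  move=> i j; case: (ltngtP i j) => [/lt_adj //|/lt_adj|/val_inj->].
    by rewrite adj_sym eC.
  by rewrite eI adj_irrefl.
case e06: (adj (nth v q 0) (nth v q 6)).
  apply: (@induced_copy _ (cycle_graph 7) f) hC7 => //.
  apply: adjf; [exact: cycle_sym|exact: cycle_irrefl|rewrite e06].
  by case=> [[|[|[|[|[|[|[|]]]]]]] // ?] [[|[|[|[|[|[|[|]]]]]]] // ?].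
apply: (@induced_copy _ (path_graph 7) f) hP7 => //.
apply: adjf; [exact: path_sym|exact: path_irrefl|rewrite e06].
by case=> [[|[|[|[|[|[|[|]]]]]]] // ?] [[|[|[|[|[|[|[|]]]]]]] // ?].
Qed.

Lemma pairwise_in (T : eqType) (r : rel T) s :
  uniq s -> {in s &, forall i j, i != j -> r i j} -> pairwise r s.
Proof.
rewrite uniq_pairwise => us rs; move: us.
by apply: (@sub_in_pairwise _ [in s]) => //; apply/allP.
Qed.

(** * Computable tests for forbidden subgraphs *)

(* The three tests below only look for forbidden subgraphs through vertex 0.
   They use [if] where [&&] would do, because vm_compute evaluates both arguments
   of the latter. *)
Definition c4_free M :=
  let s := iota 1 (size M).-1 in
  let s0 := [seq k <- s | edge M 0 k] in
  all (fun w => pairwise (edge M) [seq k <- s0 | edge M w k])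
    [seq k <- s | ~~ edge M 0 k].

Definition gem_free M :=
  let s := [seq k <- iota 1 (size M).-1 | edge M 0 k] in
  all (fun a => all (fun b => all (fun c => all (fun d => ~~ edge M c d)
          [seq d <- s | ~~ (edge M a d || edge M b d)])
        [seq c <- s | edge M b c && ~~ edge M a c])
      [seq b <- s | edge M a b]) s.

(* A vertex that extends a sequence of length 6 may be adjacent to its last
   element, see [chordless]. *)
Definition extends M p w :=
  if p is b :: p' then
    if edge M w b then
      if has (edge M w) (take 4 p') then false else w \notin p
    else false
  else false.

Fixpoint grow M k p :=
  if k is k'.+1 then
    has (fun w => if extends M p w then grow M k' (w :: p) else false)
      (iota 0 (size M))
  else true.

(** Vertex 0 may lie in the interior of the sequence: one arm is grown from it, then the sequence is
    reversed so that the other arm grows from vertex 0 again. *)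
Fixpoint grow_both M k p :=
  if grow M k (rev p) then true else
  if k is k'.+1 then
    has (fun w => if extends M p w then grow_both M k' (w :: p) else false)
      (iota 0 (size M))
  else false.

(* [nth [:: true; false] D i] lists the allowed adjacencies of the new vertex with
   vertex [i]; [D = [::]] is no restriction. *)
Fixpoint c4_free_rows (D M : seq (seq bool)) : seq (seq bool) :=
  if M is _ :: M' then
    [seq r <- [seq b :: r | r <- c4_free_rows (behead D) M',
                            b <- head [:: true; false] D] | c4_free (r :: M)]
  else [:: [::]].

(** The C_4 test prunes partial rows, entry by entry from the oldest vertex on; the other tests only
    see the complete rows that survive it. *)
Definition rows D M :=
  [seq r <- c4_free_rows D M |
     if gem_free (r :: M) then ~~ grow_both (r :: M) 6 [:: 0] else false].

Definition chordless_code M (p : seq nat) :=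
  [/\ uniq p, all (gtn (size M)) p & chordless (edge M) 0 p].

Lemma extends_chordless M (p : seq nat) w :
  size p < 7 -> w < size M -> chordless_code M p -> extends M p w ->
  chordless_code M (w :: p).
Proof.
move=> szp ltw [up ap chp]; case: p => //= b p' in szp up ap chp *.
case: ifP => // wb; case: ifP => // /negbT/hasPn nw wp.
split; rewrite /= ?ltw ?wp //.
move=> [|i] [|j] //= ltij ne.
  case: j => [|j] //= in ltij ne *.
  apply/negbTE/nw; rewrite ltnS ltnS in ltij.
  (* Position j of [p'] is position j + 2 of the new sequence, and [ne] excludes j = 4. *)
  have lt4 : j < 4 by move: ltij ne szp; case: j => [|[|[|[|[|j]]]]] //=;
    case: (size p') => [|[|[|[|[|[|]]]]]].
  by rewrite -(nth_take 0 lt4) mem_nth // size_take; case: ifP.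
apply: chp => //; move: ltij szp; rewrite !ltnS => /andP[ij js] szp.
rewrite xpair_eqE negb_and; apply/orP; right; apply: contraTneq js => ->.
by rewrite -leqNgt.
Qed.

Lemma grow_chordless M k (p : seq nat) :
  size p + k = 7 -> chordless_code M p -> grow M k p ->
  exists2 q, size q = 7 & chordless_code M q.
Proof.
elim: k p => [|k IH] p; first by rewrite addn0; exists p.
rewrite addnS => szp chp /hasP[w]; rewrite mem_iota /= => ltw.
case: ifP => // /(extends_chordless _ ltw chp) chwp; apply: IH => //.
by apply: chwp; rewrite -szp ltnS leq_addr.
Qed.

(** Reversing a sequence of length 7 preserves the exempt pair (0, 6); a shorter sequence has no
    such pair. *)
Lemma chordless_rev M (p : seq nat) :
  size p <= 7 -> chordless_code M p -> chordless_code M (rev p).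
Proof.
move=> szp [up ap chp]; split; rewrite ?rev_uniq ?all_rev //.
move=> i j; rewrite size_rev => /andP[ij js] ne.
have eqj : (j == i.+1) = (size p - i.+1 == (size p - j.+1).+1).
  by apply/eqP/eqP; lia.
rewrite !nth_rev ?(ltn_trans ij) // edgeC chp ?eqj //; first by lia.
move: ne; rewrite !xpair_eqE !negb_and => ne; lia.
Qed.

Lemma grow_both_chordless M k (p : seq nat) :
  size p + k = 7 -> chordless_code M p -> grow_both M k p ->
  exists2 q, size q = 7 & chordless_code M q.
Proof.
elim: k p => [|k IH] p szp chp /=.
  by exists p => //; rewrite -szp addn0.
case: ifP => [gr _|_ /hasP[w]].
  apply: (@grow_chordless M k.+1 (rev p)) => //; first by rewrite size_rev.
  by apply: chordless_rev chp; rewrite -szp leq_addr.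
rewrite mem_iota /= => ltw.
case: ifP => // /(extends_chordless _ ltw chp) chwp; apply: IH => //.
  by rewrite -szp addnS.
by apply: chwp; rewrite -szp addnS ltnS leq_addr.
Qed.

(** * Soundness of the tests for the given class of graphs *)

Section Soundness.
Variable G : sgraph.
Hypotheses (hP7 : free_of (path_graph 7) G) (hC7 : free_of (cycle_graph 7) G)
  (hC4 : free_of (cycle_graph 4) G) (hgem : free_of gem G).

Local Notation codeG := (code (@adj G)).

Lemma edge_adj (v : G) x i j :
  i < size x -> j < size x -> edge (codeG x) i j = adj (nth v x i) (nth v x j).
Proof.
move=> lti ltj; have [->|ne] := eqVneq i j.
  by rewrite adj_irrefl edge_irrefl.
by apply: edge_code => //; apply: adj_sym.
Qed.

Lemma c4_free_code (x : seq G) : uniq x -> c4_free (codeG x).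
Proof.
case: x => [//|v x] uq; rewrite /c4_free size_code; set X := nth v (v :: x).
have E i j : i <= size x -> j <= size x -> edge (codeG (v :: x)) i j = adj (X i) (X j).
  by move=> *; apply: edge_adj.
have neq i j : i <= size x -> j <= size x -> i != j -> X i != X j.
  by move=> *; rewrite nth_uniq.
move: (codeG _) E => M E /=.
apply/allP => w; rewrite mem_filter mem_iota add1n ltnS => /and3P[n0w w0 wx].
apply: pairwise_in => [|k l]; first by rewrite !filter_uniq ?iota_uniq.
rewrite !mem_filter !mem_iota !add1n !ltnS.
move=> /and4P[wk k0 _ kx] /and4P[wl l0 _ lx] nkl.
rewrite E //; rewrite !E // in n0w wk k0 wl l0.
apply: (@no_square _ (X 0) (X k) (X w) (X l)) => //; last by rewrite adj_sym.
- by apply: neq => //; rewrite eq_sym -lt0n.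
- exact: neq.
- by rewrite adj_sym.
Qed.

Lemma gem_free_code (x : seq G) : gem_free (codeG x).
Proof.
case: x => [//|v x]; rewrite /gem_free size_code; set X := nth v (v :: x).
have E i j : i <= size x -> j <= size x -> edge (codeG (v :: x)) i j = adj (X i) (X j).
  by move=> *; apply: edge_adj.
move: (codeG _) E => M E /=.
apply/allP => a; rewrite mem_filter mem_iota add1n ltnS => /and3P[a0 _ ax].
apply/allP => b; rewrite !mem_filter mem_iota add1n ltnS => /and4P[ab b0 _ bx].
apply/allP => c; rewrite !mem_filter mem_iota add1n ltnS.
move=> /and4P[/andP[bc nac] c0 _ cx].
apply/allP => d; rewrite !mem_filter mem_iota add1n ltnS negb_or.
move=> /and4P[/andP[nad nbd] d0 _ dx].
rewrite !E // in a0 ab b0 bc nac c0 nad nbd d0 *.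
apply: contra nad => cd.
exact: (@no_gem _ (X 0) (X a) (X b) (X c) (X d)).
Qed.

Lemma grow_both_code (x : seq G) : uniq x -> ~~ grow_both (codeG x) 6 [:: 0].
Proof.
case: x => [//|v x] uq; apply/negP => gr.
have ch0 : chordless_code (codeG (v :: x)) [:: 0] by split=> // i j /=; lia.
have [q sq [uqq aq chq]] := @grow_both_chordless _ 6 [:: 0] erefl ch0 gr.
rewrite size_code in aq.
pose y := map (nth v (v :: x)) q.
apply: (@no_chordless7 _ v y) => //; first by rewrite size_map.
  rewrite map_inj_in_uniq // => i j /(allP aq) /= lti /(allP aq) /= ltj.
  by move/eqP; rewrite nth_uniq // => /eqP.
move=> i j; rewrite size_map => /andP[ij js] ne.
rewrite !(nth_map 0) ?(ltn_trans ij) // -edge_adj; last 2 first.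
- by apply: (allP aq); rewrite mem_nth // (ltn_trans ij).
- by apply: (allP aq); rewrite mem_nth.
by apply: chq; rewrite ?ij.
Qed.

(** Completeness of the enumeration: a row that failed a test would exhibit a forbidden subgraph of
    G. *)
Lemma mem_rows (D : seq (seq bool)) (v y : G) x :
  uniq (y :: x) ->
  (forall i, i < size x -> adj y (nth v x i) \in nth [:: true; false] D i) ->
  map (adj y) x \in rows D (codeG x).
Proof.
move=> uq compat.
rewrite mem_filter -/(codeG (y :: x)) gem_free_code grow_both_code //=.
elim: x D uq compat => [//|z x IH] D uq compat /=.
rewrite mem_filter; apply/andP; split; first exact: (@c4_free_code (y :: z :: x)).
apply/allpairsP; exists (map (adj y) x, adj y z); split=> //=.
  apply: IH; first by move: uq => /=; rewrite inE negb_or => /and3P[/andP[_ ->] _ ->].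
  by move=> i lti; rewrite nth_behead; apply: compat i.+1 lti.
by rewrite -nth0; apply: compat 0 _.
Qed.
End Soundness.

(** * The coded Petersen graph and the search for it *)

Definition kneser (p q : nat * nat) :=
  [&& p.1 != q.1, p.1 != q.2, p.2 != q.1 & p.2 != q.2].

(* Read from the end: a vertex, its three neighbors, and the further neighbors of
   these, which is the order in which the search meets them. *)
Definition labels : seq (nat * nat) :=
  [:: (1, 2); (0, 2); (0, 3); (1, 3); (1, 4); (0, 4);
      (3, 4); (2, 4); (2, 3); (0, 1)].

Definition petersen_code := code kneser labels.

Fixpoint embeddings M P : seq (seq nat) :=
  if P is r :: P' then
    [seq i :: p | p <- embeddings M P',
       i <- [seq i <- iota 0 (size M) |
               (i \notin p) && (map (edge M i) p == r)]]
  else [:: [::]].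

Arguments embeddings : simpl never.

Lemma embeddingsP M P p :
  p \in embeddings M P ->
  [/\ uniq p, all (gtn (size M)) p & code (edge M) p = P].
Proof.
elim: P p => [|r P IH] p; first by rewrite inE => /eqP->.
case/allpairsPdep => q [i [/IH[uq aq eq_code]]].
rewrite mem_filter mem_iota => /andP[/andP[iq /eqP<-] /= lti] ->.
by rewrite /= iq uq lti aq eq_code.
Qed.

Definition neighbors M u := [seq i <- iota 0 (size M) | edge M u i].

(* Complete the first vertex and its neighbors to degree 3; then a vertex of
   degree 1 always remains unless the graph is the Petersen graph. *)
Definition pick_vertex M :=
  if size M < 10 then nth 0 [:: 0; 0; 1; 2; 2; 3; 3; 4; 4; 5] (size M)
  else last 0 [seq i <- iota 0 (size M) | size (neighbors M i) == 1].

(** These are the constraints that [good_neighbor] guarantees. *)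
Definition new_neighbor M u :=
  mkseq (fun i => if i == u then [:: true]
                  else if edge M u i then [:: false] else [:: true; false])
    (size M).

(* [T] marks the edges of [M] known to be good. The induced subgraph [M] is extended
   by a good neighbor of [pick_vertex M] in all possible ways. *)
Fixpoint forces_petersen k M T :=
  if k is k'.+1 then
    if (if size M == 10 then embeddings M petersen_code != [::] else false)
    then true else
    let u := pick_vertex M in let s := neighbors M u in
    if [&& u < size M, size s < 3 & all (edge T u) s] then
      all (fun r => forces_petersen k' (r :: M)
                      (mkseq (fun i => i == u) (size M) :: T))
        (rows (new_neighbor M u) M)
    else false
  else false.

(** A branch closes when no row is admissible or when its 10 vertices form the Petersen graph; the
    fuel suffices for all branches. *)
Lemma search : forces_petersen 15 [:: [::]] [:: [::]].
Proof. by vm_compute. Qed.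

(** * Good edges and the existence of an induced Petersen graph *)

Section Search.
Variable G : sgraph.
Hypotheses (hP7 : free_of (path_graph 7) G) (hC7 : free_of (cycle_graph 7) G)
  (hC4 : free_of (cycle_graph 4) G) (hgem : free_of gem G).

(* N(u) is a trivially perfect graph, i.e. the comparability graph of a forest, and
   the good neighbors of u are the leaves of this forest. *)
Definition good_edge (u w : G) :=
  adj u w /\ is_clique (neighborhood u :&: neighborhood w).

Lemma good_edgeC u w : good_edge u w -> good_edge w u.
Proof. by rewrite /good_edge adj_sym setIC. Qed.

Lemma good_neighbor (u : G) (s : seq G) :
  ~ bisimplicial u -> size s < 3 -> {in s, forall a, good_edge u a} ->
  exists2 w, good_edge u w & {in s, forall a, w != a /\ ~~ adj w a}.
Proof.
move=> nbu szs good_s.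
pose K a := [set w in neighborhood u | (w == a) || adj w a].
pose W := [set w in neighborhood u | all (fun a => w \notin K a) s].
have cliqueK a : a \in s -> is_clique (K a).
  move=> /good_s[ua cl] b c; rewrite !inE.
  case/andP=> ub /orP[/eqP->|ba]; case/andP=> uc /orP[/eqP->|ca] // bc.
  - by rewrite eqxx in bc.
  - by rewrite adj_sym.
  - by apply: cl; rewrite // !inE ?ub ?uc adj_sym.
have [w0 w0W] : exists w, w \in W.
  apply/set0Pn/negP => /eqP W0; apply: nbu.
  (* If W were empty, the at most two cliques [K a] would cover N(u). *)
  exists (if s is a :: _ then K a else set0).
  exists (if s is _ :: b :: _ then K b else set0).
  split.
  - by case: (s) cliqueK => [|a s'] cl; [move=> ? ?; rewrite inE|apply/cl/mem_head].
  - case: (s) cliqueK => [|a [|b s']] cl; try by move=> ? ?; rewrite inE.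
    by apply: cl; rewrite !inE eqxx orbT.
  apply/setP => w; move/setP/(_ w): W0; rewrite !inE.
  case uw: (adj u w); last by case: (s) => [|a [|b s']]; rewrite !inE ?uw.
  case: (s) szs => [|a [|b [|c s']]] //= _; rewrite !inE uw /= ?andbT.
  - by move/negbFE=> ->.
  - by move=> /negbT; rewrite negb_and !negbK.
case: (arg_minnP (fun w => #|K w|) w0W) => w wW min_w {w0 w0W}.
have: w \in W by []; rewrite inE inE => /andP[uw /allP ws].
have {}ws : {in s, forall a, w != a /\ ~~ adj w a}.
  by move=> a /ws; rewrite !inE uw /= negb_or => /andP.
exists w => //; split=> // c d; rewrite !inE => /andP[uc wc] /andP[ud wd] cd.
apply/negP => /negP ncd.
(* The set [K c] is strictly contained in [K w], since d lies only in the latter; so c in W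
   contradicts minimality. *)
suff: c \in W.
  move/min_w; rewrite leqNgt => /negP; apply; apply: proper_card.
  apply/properP; split; last first.
    by exists d; rewrite !inE ud /= ?[adj d w]adj_sym ?wd ?orbT // negb_or
      eq_sym cd adj_sym.
  apply/subsetP => z; rewrite !inE => /andP[uz]; rewrite uz /=.
  case/orP=> [/eqP->|zc]; first by rewrite adj_sym wc orbT.
  apply/orP; have [->|zw] := eqVneq z w; [by left|right].
  apply/negP => /negP nzw.
  have cw : adj c w by rewrite adj_sym.
  (* In N(u), the path z, c, w, d is a P_4 unless z and d are adjacent, and then it closes to a
     C_4. *)
  have zd : adj z d by apply: (no_gem hgem uz uc uw ud).
  move/negP: ncd; apply; apply: (no_square hC4 zw cd zc cw wd) => //.
  by rewrite adj_sym.
rewrite inE inE uc; apply/allP => a /[dup] sa /ws[wa nwa].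
rewrite !inE uc negb_or; apply/andP; split.
  by apply: contraNneq nwa => <-.
apply/negP => ca; have [ua cla] := good_s a sa.
(* The path a, c, w, d in N(u) forces this edge, so c and d both lie in the clique N(u) :&: N(a). *)
have ad : adj a d.
  apply: (no_gem hgem ua uc uw ud) => //; try by rewrite adj_sym.
by move/negP: ncd; apply; apply: cla => //; rewrite !inE ?uc ?ud // adj_sym.
Qed.

Hypothesis no_bisimplicial : forall u : G, ~ bisimplicial u.

(** The search is followed along the branch dictated by G: at each stage [good_neighbor] yields a
    vertex whose row is among those explored. *)
Lemma forces_petersenP (v : G) k M T x :
  uniq x -> code adj x = M ->
  (forall i j, i < size x -> j < size x -> edge T i j ->
     good_edge (nth v x i) (nth v x j)) ->
  forces_petersen k M T ->
  exists2 y : seq G, uniq y & code adj y = petersen_code.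
Proof.
elim: k M T x => [//|k IH] M T x uqx eqM goodT.
rewrite [forces_petersen _ _ _]/forces_petersen -/forces_petersen.
have szM : size M = size x by rewrite -eqM size_code.
case: ifP => [|_].
  case: ifP => // _; case E: (embeddings _ _) => [//|p ps] _.
  have /embeddingsP[uqp /allP ap eqp] : p \in embeddings M petersen_code.
    by rewrite E mem_head.
  rewrite szM in ap.
  exists (map (nth v x) p).
    rewrite map_inj_in_uniq // => i j /ap /= lti /ap /= ltj.
    by move/eqP; rewrite nth_uniq // => /eqP.
  rewrite -eqp; apply: (@eq_code _ _ _ _ v 0); rewrite size_map // => i j.
  case/andP=> ij js; rewrite !(nth_map 0) // ?(ltn_trans ij) // -eqM (edge_adj v) //.
    by apply: ap; rewrite mem_nth // (ltn_trans ij).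
  by apply: ap; rewrite mem_nth.
set u := pick_vertex M; set s := neighbors M u; rewrite szM.
case: ifP => // /and3P[ltu szs /allP Ts] /allP forces.
have mem_s i : i \in s = (i < size x) && adj (nth v x u) (nth v x i).
  rewrite mem_filter mem_iota /= szM andbC; case: ltnP => //= lti.
  by rewrite -eqM (edge_adj v).
have good_s : {in map (nth v x) s, forall a, good_edge (nth v x u) a}.
  move=> _ /mapP[i si ->]; apply: goodT => //; last exact: Ts.
  by move: si; rewrite mem_s => /andP[].
have [|w good_w far_w] := good_neighbor (@no_bisimplicial _) _ good_s.
  by rewrite size_map.
have [uw _] := good_w.
have wx : w \notin x.
  apply/negP => wx; have [] := far_w w; last by rewrite eqxx.
  apply/mapP; exists (index w x); last by rewrite nth_index.
  by rewrite mem_s index_mem wx nth_index.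
have uqwx : uniq (w :: x) by rewrite /= wx.
apply: (IH _ _ (w :: x) uqwx) (forces (map (adj w) x) _) => /=.
- by rewrite eqM.
- move=> [|i] [|j] //=; rewrite !ltnS => lti ltj.
  + by rewrite nth_mkseq // => /eqP->; apply: good_edgeC.
  + by rewrite nth_mkseq // => /eqP->.
  exact: goodT.
rewrite -eqM; apply: (@mem_rows _ hP7 hC7 hC4 hgem _ v) => // i lti.
rewrite nth_mkseq ?size_code //; case: eqP => [->|_].
  by rewrite adj_sym uw inE.
rewrite (edge_adj v) //; case: ifP => [ui|_]; last by case: adj.
have /far_w[_ nwi] : nth v x i \in map (nth v x) s by rewrite map_f // mem_s lti.
by rewrite inE (negPf nwi).
Qed.

Lemma contains_petersen (v : G) :
  exists2 x : seq G, uniq x & code adj x = petersen_code.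
Proof.
have good0 i j : i < size [:: v] -> j < size [:: v] -> edge [:: [::]] i j ->
  good_edge (nth v [:: v] i) (nth v [:: v] j) by case: i j => [|i] [|j].
exact: (@forces_petersenP v 15 _ _ [:: v] erefl erefl good0 search).
Qed.
End Search.

(** * Computed attachments to the Petersen graph *)

Definition closed_row i := mkseq (fun j => (i == j) || edge petersen_code i j) 10.

Definition stars := mkseq closed_row 10.

Definition clique_row (r : seq bool) :=
  pairwise (edge petersen_code) [seq i <- iota 0 10 | nth false r i].

Lemma petersen_rows :
  all (fun r => (r \in stars) || clique_row r) (rows [::] petersen_code).
Proof. by vm_compute. Qed.

(** Here [b] is the adjacency of two outside vertices with rows [r1] and [r2]. Clones follow the
    blowup pattern; of the other vertices, adjacent ones agree on the Petersen graph. *)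
Definition compatible r1 b r2 :=
  match r1 \in stars, r2 \in stars with
  | true, true => b == nth false r1 (index r2 stars)
  | false, false => b ==> (r1 == r2)
  | _, _ => true
  end.

Lemma petersen_row_pairs :
  all (fun r1 => all (fun r => compatible r1 (head false r) (behead r)) (rows [::] (r1 :: petersen_code)))
    (rows [::] petersen_code).
Proof. by vm_compute. Qed.

(** A closed neighborhood contains three pairwise nonadjacent vertices, and at least two of them
    survive a change of one entry. *)
Lemma star_change_not_clique :
  all (fun r => all (fun p => all (fun b => ~~ clique_row (set_nth false r p b))
    [:: true; false]) (iota 0 10)) stars.
Proof. by vm_compute. Qed.

Lemma stars_uniq : uniq stars.
Proof. by vm_compute. Qed.

Lemma nth_star i : i < 10 -> nth [::] stars i = closed_row i.
Proof. by move=> lti; rewrite nth_mkseq. Qed.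

Lemma nth_closed_row i j :
  j < 10 -> nth false (closed_row i) j = (i == j) || edge petersen_code i j.
Proof. by move=> ltj; rewrite nth_mkseq. Qed.

Lemma mem_stars i : i < 10 -> closed_row i \in stars.
Proof. by move=> lti; rewrite -nth_star // mem_nth // size_mkseq. Qed.

Lemma starsP r : r \in stars -> exists2 i, i < 10 & r = closed_row i.
Proof. by case/mapP=> i; rewrite mem_iota => /= lti ->; exists i. Qed.

Lemma index_star i : i < 10 -> index (closed_row i) stars = i.
Proof.
by move=> lti; rewrite -nth_star // index_uniq ?size_mkseq ?stars_uniq.
Qed.

Lemma closed_row_inj i j : i < 10 -> j < 10 -> closed_row i = closed_row j -> i = j.
Proof. by move=> lti ltj eq_ij; rewrite -(index_star lti) eq_ij index_star. Qed.

Lemma pairwise_neq (T : eqType) (r : rel T) s : symmetric r ->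
  pairwise r s -> {in s &, forall i j, i != j -> r i j}.
Proof.
move=> rC; elim: s => //= a s IH /andP[/allP ra /IH{}IH] i j.
rewrite !inE => /predU1P[->|si] /predU1P[->|sj]; rewrite ?eqxx // => ne.
- exact: ra.
- by rewrite rC ra.
- exact: IH.
Qed.

Lemma clique_rowP r i j :
  clique_row r -> i < 10 -> j < 10 -> nth false r i -> nth false r j -> i != j ->
  edge petersen_code i j.
Proof.
move=> cl lti ltj ri rj; apply: (pairwise_neq (@edgeC petersen_code) cl) => //;
  by rewrite mem_filter mem_iota ?ri ?rj /= ?lti ?ltj.
Qed.

(** * The blowup Q and the attachments of the vertices outside it *)

Section Blowup.
Variable G : sgraph.
Hypotheses (hP7 : free_of (path_graph 7) G) (hC7 : free_of (cycle_graph 7) G)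
  (hC4 : free_of (cycle_graph 4) G) (hgem : free_of gem G).

Definition petersen_in (x : seq G) := uniq x /\ code adj x = petersen_code.

(** Closed adjacency makes each vertex of the Petersen graph a clone of itself, so that it belongs
    to Q. *)
Definition trace (x : seq G) y := [seq (y == z) || adj y z | z <- x].

Definition in_star x y := trace x y \in stars.

Lemma petersen_size x : petersen_in x -> size x = 10.
Proof. by case=> _ /(congr1 size); rewrite size_code => ->. Qed.

Lemma petersen_adj v x i j : petersen_in x -> i < 10 -> j < 10 ->
  adj (nth v x i) (nth v x j) = edge petersen_code i j.
Proof.
move=> px lti ltj; have sx := petersen_size px; case: px => _ <-.
by rewrite (edge_adj v) ?sx.
Qed.

Lemma nth_trace v x y i : petersen_in x -> i < 10 ->
  nth false (trace x y) i = (y == nth v x i) || adj y (nth v x i).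
Proof. by move=> px lti; rewrite (nth_map v) ?petersen_size. Qed.

Lemma trace_nth v x i : petersen_in x -> i < 10 ->
  trace x (nth v x i) = closed_row i.
Proof.
move=> px lti; have sx := petersen_size px.
apply: (@eq_from_nth _ false); first by rewrite size_map size_mkseq.
rewrite size_map sx => j ltj; rewrite (nth_trace v) // nth_closed_row //.
by rewrite petersen_adj // nth_uniq ?sx //; case: px.
Qed.

Lemma trace_notin x y : y \notin x -> trace x y = map (adj y) x.
Proof.
move=> yx; apply/eq_in_map => z zx.
by case: eqP => [eyz|//]; rewrite eyz zx in yx.
Qed.

Lemma trace_rows x y : petersen_in x -> y \notin x ->
  trace x y \in rows [::] petersen_code.
Proof.
move=> px yx; have [uqx <-] := px; rewrite trace_notin //.
apply: (@mem_rows _ hP7 hC7 hC4 hgem [::] y) => [|i _]; first by rewrite /= yx.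
by rewrite nth_nil; case: adj.
Qed.

Lemma in_star_mem x y : petersen_in x -> y \in x -> in_star x y.
Proof.
move=> px yx; rewrite /in_star -(nth_index y yx) trace_nth ?mem_stars //;
  by rewrite -(petersen_size px) index_mem.
Qed.

Lemma trace_clique x y : petersen_in x -> ~~ in_star x y -> clique_row (trace x y).
Proof.
move=> px ny; have yx : y \notin x by apply: contra ny; apply: in_star_mem.
by have := allP petersen_rows _ (trace_rows px yx);
  rewrite -/(in_star x y) (negPf ny).
Qed.

Lemma trace_compatible x y z : petersen_in x -> y \notin x -> z \notin y :: x ->
  compatible (trace x y) (adj z y) (trace x z).
Proof.
move=> px yx zyx; have zx : z \notin x.
  by apply: contra zyx => zx; rewrite inE zx orbT.
have [uqx codex] := px.
have z_row : adj z y :: trace x z \in rows [::] (trace x y :: petersen_code).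
  rewrite !trace_notin // -codex.
  apply: (@mem_rows _ hP7 hC7 hC4 hgem [::] z z (y :: x)) => [|i _].
    by rewrite cons_uniq zyx /= yx.
  by rewrite nth_nil; case: adj.
exact: (allP (allP petersen_row_pairs _ (trace_rows px yx)) _ z_row).
Qed.

(** If one of the two vertices is in [x], the trace of the other decides; otherwise the computation
    on pairs of rows does. *)
Lemma star_adj x y z i j : petersen_in x -> i < 10 -> j < 10 ->
  trace x y = closed_row i -> trace x z = closed_row j ->
  (y == z) || adj y z = (i == j) || edge petersen_code i j.
Proof.
move=> px lti ltj ty tz; have sx := petersen_size px.
have [yx|yx] := boolP (y \in x).
  have ltk : index y x < 10 by rewrite -sx index_mem.
  have <- : index y x = i.
    by apply: closed_row_inj; rewrite // -ty -(trace_nth y px) ?nth_index.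
  have := nth_trace y z px ltk; rewrite nth_index // tz nth_closed_row // => tz_y.
  by rewrite [y == z]eq_sym adj_sym -tz_y [j == _]eq_sym edgeC.
have [zx|zx] := boolP (z \in x).
  have ltk : index z x < 10 by rewrite -sx index_mem.
  have <- : index z x = j.
    by apply: closed_row_inj; rewrite // -tz -(trace_nth z px) ?nth_index.
  by have := nth_trace z y px ltk; rewrite nth_index // ty nth_closed_row.
have [eyz|neyz] := eqVneq y z.
  by rewrite (closed_row_inj lti ltj) ?eqxx // -ty -tz eyz.
have := trace_compatible px yx; move/(_ z).
rewrite inE negb_or eq_sym neyz zx /compatible ty tz !mem_stars //.
by move/(_ isT)/eqP; rewrite index_star // nth_closed_row // adj_sym.
Qed.

Lemma outside_adj x y z : petersen_in x -> ~~ in_star x y -> ~~ in_star x z ->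
  adj y z -> trace x y = trace x z.
Proof.
move=> px ny nz yz.
have yx : y \notin x by apply: contra ny; apply: in_star_mem.
have zx : z \notin x by apply: contra nz; apply: in_star_mem.
have neyz : z != y by apply: contraTneq yz => ->; rewrite adj_irrefl.
have := trace_compatible px yx; move/(_ z).
rewrite inE negb_or neyz zx /compatible -!/(in_star x _) (negPf ny) (negPf nz) adj_sym yz.
by move/(_ isT)/eqP.
Qed.

(** The clone q sees the other vertices of [x] as vertex p does, and the traces of vertices outside
    Q change at most in entry p. *)
Lemma petersen_swap x q p : petersen_in x -> p < 10 -> trace x q = closed_row p ->
  petersen_in (set_nth q x p q) /\
  forall y, ~~ in_star x y -> ~~ in_star (set_nth q x p q) y.
Proof.
move=> px ltp tq; have sx := petersen_size px; set x' := set_nth q x p q.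
have q_nth j : j < 10 -> (q == nth q x j) || adj q (nth q x j) =
    (p == j) || edge petersen_code p j.
  by move=> ltj; rewrite -nth_trace // tq nth_closed_row.
have neq j : j < 10 -> j != p -> q != nth q x j.
  move=> ltj; apply: contraNneq => eqj.
  by rewrite (@closed_row_inj j p) // -tq [in RHS]eqj trace_nth.
have nth_x' j : nth q x' j = if j == p then q else nth q x j by rewrite nth_set_nth.
have sx' : size x' = 10 by rewrite size_set_nth sx; apply/maxn_idPr.
have px' : petersen_in x'.
  split.
    apply/(uniqP q) => i j; rewrite !inE sx' !nth_x' => lti ltj.
    case: ifP => [/eqP->|/negbT ip]; case: ifP => [/eqP-> //|/negbT jp].
    - by move/eqP; rewrite (negPf (neq _ ltj jp)).
    - by move/esym/eqP; rewrite (negPf (neq _ lti ip)).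
    by move/eqP; rewrite nth_uniq ?sx //; [move/eqP|case: px].
  case: (px) => _ <-; apply: (@eq_code _ _ _ _ q q); first by rewrite sx' sx.
  rewrite sx' => i j /andP[ltij ltj]; rewrite !nth_x'.
  have lti := ltn_trans ltij ltj; rewrite [RHS]petersen_adj //.
  case: ifP => [/eqP eip|_]; case: ifP => [/eqP ejp|/negbT jp].
  - by rewrite eip ejp ltnn in ltij.
  - have := q_nth j ltj; rewrite (negPf (neq _ ltj jp)) orFb => ->.
    by rewrite eq_sym (negPf jp) eip.
  - have ip : i != p by rewrite -ejp ltn_eqF.
    have := q_nth i lti; rewrite (negPf (neq _ lti ip)) orFb adj_sym => ->.
    by rewrite eq_sym (negPf ip) edgeC ejp.
  - by rewrite petersen_adj.
split=> // y ny; apply/negP => /starsP[i lti ty'].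
(* Undoing the swap changes only entry p, so the clique [trace x y] would be star i with one entry
   changed. *)
have := allP (allP (allP star_change_not_clique _ (mem_stars lti)) p _)
  (nth false (trace x y) p).
rewrite mem_iota => /(_ ltp); suff <- : trace x y =
    set_nth false (closed_row i) p (nth false (trace x y) p).
  by rewrite trace_clique //; case: nth => /(_ isT).
rewrite -ty'; apply: (@eq_from_nth _ false).
  by rewrite size_set_nth !size_map sx sx'; apply/esym/maxn_idPr.
rewrite size_map sx => j ltj; rewrite nth_set_nth /=.
by case: eqP => [->//|/eqP jp]; rewrite !(@nth_trace q) // nth_x' (negPf jp).
Qed.

(* Otherwise y and z would have distinct traces on the Petersen graph obtained by
   swapping q in. *)
Lemma outside_same_attachment x y z q : petersen_in x ->
  ~~ in_star x y -> ~~ in_star x z -> in_star x q -> adj y z -> adj y q -> adj z q.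
Proof.
move=> px ny nz /starsP[p ltp tq] yz yq.
have [px' out'] := petersen_swap px ltp tq; set x' := set_nth _ _ _ _ in px' out'.
have q_nth : nth q x' p = q by rewrite nth_set_nth /= eqxx.
have := outside_adj px' (out' _ ny) (out' _ nz) yz.
move/(congr1 (fun r => nth false r p)); rewrite !(@nth_trace q) // q_nth yq orbT.
case: eqP => [ezq|_ /esym //].
by case/negP: nz; rewrite ezq /in_star tq mem_stars.
Qed.

(** Two neighbors of y in Q that clone different vertices can both be swapped in; the new trace of y
    is a clique containing both. *)
Lemma attachment_clique x y : petersen_in x -> ~~ in_star x y ->
  is_clique [set q | in_star x q && adj y q].
Proof.
move=> px ny q1 q2; rewrite !inE => /andP[s1 yq1] /andP[s2 yq2] ne.
have [p1 ltp1 t1] := starsP s1; have [p2 ltp2 t2] := starsP s2.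
have := star_adj px ltp1 ltp2 t1 t2; rewrite (negPf ne) /= => ->.
have [//|nep] := eqVneq p1 p2.
have [px1 out1] := petersen_swap px ltp1 t1; set x1 := set_nth _ _ _ _ in px1 out1.
have sx1 := petersen_size px1.
have q1_nth : nth q1 x1 p1 = q1 by rewrite nth_set_nth /= eqxx.
(* The second swap needs q2 to remain a clone of p2 after the first one. *)
have t2' : trace x1 q2 = closed_row p2.
  have sx := petersen_size px.
  apply: (@eq_from_nth _ false); first by rewrite size_map size_mkseq.
  rewrite size_map sx1 => j ltj; rewrite (@nth_trace q1) // nth_set_nth /=.
  have [->|_] := eqVneq j p1.
    by rewrite (star_adj px ltp2 ltp1 t2 t1) nth_closed_row.
  by rewrite -(nth_trace q1 q2 px) // t2.
have [px2 out2] := petersen_swap px1 ltp2 t2'; set x2 := set_nth _ _ _ _ in px2 out2.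
have cl := trace_clique px2 (out2 _ (out1 _ ny)).
apply: (clique_rowP cl) => //.
  rewrite (@nth_trace q1) // (set_nth_default q2) ?petersen_size //.
  rewrite nth_set_nth /= (negPf nep) (set_nth_default q1) ?sx1 //.
  by rewrite q1_nth yq1 orbT.
by rewrite (@nth_trace q2) // nth_set_nth /= eqxx yq2 orbT.
Qed.
End Blowup.

(** * The coded Petersen graph is the Kneser graph K(5,2) *)

Definition petersen_sets : seq {set 'I_5} :=
  [seq [set inord p.1; inord p.2] | p <- labels].

Definition petersen_set i := nth set0 petersen_sets i.

Lemma label_small p : p \in labels -> p.1 < 5 /\ p.2 < 5.
Proof.
move=> lp; apply/andP.
exact: (allP (isT : all (fun p => (p.1 < 5) && (p.2 < 5)) labels) p lp).
Qed.

Lemma inord_label p q : p \in labels -> q \in labels ->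
  [/\ (inord p.1 == inord q.1 :> 'I_5) = (p.1 == q.1),
      (inord p.1 == inord q.2 :> 'I_5) = (p.1 == q.2),
      (inord p.2 == inord q.1 :> 'I_5) = (p.2 == q.1) &
      (inord p.2 == inord q.2 :> 'I_5) = (p.2 == q.2)].
Proof.
by move=> /label_small[? ?] /label_small[? ?]; split; rewrite -val_eqE /= !inordK.
Qed.

Lemma disjoint_labels p q : p \in labels -> q \in labels ->
  [disjoint [set inord p.1; inord p.2 : 'I_5] & [set inord q.1; inord q.2]] =
  kneser p q.
Proof.
move=> lp lq; have [e11 e12 e21 e22] := inord_label lp lq.
by rewrite disjoints_subset subUset !sub1set !inE !negb_or e11 e12 e21 e22 -andbA.
Qed.

Lemma petersen_sets_uniq : uniq petersen_sets.
Proof.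
rewrite map_inj_in_uniq // => p q lp lq eq_pq.
have [e11 e12 e21 e22] := inord_label lp lq.
have : inord p.1 \in [set inord q.1; inord q.2 : 'I_5] by rewrite -eq_pq set21.
have : inord p.2 \in [set inord q.1; inord q.2 : 'I_5] by rewrite -eq_pq set22.
rewrite !inE e11 e12 e21 e22 => p2 p1.
have := allP (allP (_ : all (fun p => all (fun q =>
  (p.2 == q.1) || (p.2 == q.2) ==> ((p.1 == q.1) || (p.1 == q.2)) ==> (p == q))
  labels) labels) p lp) q lq.
by rewrite p1 p2 => /(_ isT)/eqP.
Qed.

Lemma petersen_sets_disjoint i j A B : i < 10 -> j < 10 ->
  petersen_set i = A -> petersen_set j = B ->
  [disjoint A & B] = edge petersen_code i j.
Proof.
move=> lti ltj <- <-; rewrite /petersen_set !(nth_map (0, 0)) // disjoint_labels ?mem_nth //.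
have [->|neij] := eqVneq i j; first by rewrite edge_irrefl /kneser eqxx.
rewrite (edge_code (0, 0)) // => -[a b] [c d]; rewrite /kneser /=.
rewrite [c == a]eq_sym [c == b]eq_sym [d == a]eq_sym [d == b]eq_sym.
by congr (_ && _); rewrite andbCA.
Qed.

Definition petersen_index (A : petersen) := index (val A) petersen_sets.

Lemma petersen_set_mem (A : petersen) : val A \in petersen_sets.
Proof.
have /cards2P[i [j [neij ->]]] := valP A.
have : ((val i, val j) \in labels) || ((val j, val i) \in labels).
  by move: neij; case: i j => [[|[|[|[|[|]]]]] // ?] [[|[|[|[|[|]]]]] // ?].
case/orP=> lij; apply/mapP; [exists (val i, val j) | exists (val j, val i)] => //=.
  by rewrite !inord_val.
by rewrite !inord_val setUC.
Qed.

Lemma petersen_index_small A : petersen_index A < 10.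
Proof. by have := petersen_set_mem A; rewrite -index_mem. Qed.

Lemma petersen_set_index A : petersen_set (petersen_index A) = val A.
Proof. exact/nth_index/petersen_set_mem. Qed.

Lemma petersen_index_inj : injective petersen_index.
Proof.
by move=> A B eqAB; apply: val_inj; rewrite -!petersen_set_index eqAB.
Qed.

Lemma petersen_index_adj (A B : petersen) :
  adj A B = edge petersen_code (petersen_index A) (petersen_index B).
Proof.
apply: petersen_sets_disjoint; by
  [exact: petersen_index_small|exact: petersen_set_index].
Qed.

Lemma petersen_index_surj i : i < 10 -> exists A, petersen_index A = i.
Proof.
move=> lti; have card2 : #|petersen_set i| == 2.
  rewrite /petersen_set (nth_map (0, 0)) // cards2; set p := nth _ _ _.
  have lp : p \in labels by rewrite mem_nth.
  have [_ -> _ _] := inord_label lp lp.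
  by have := allP (isT : all (fun p => p.1 != p.2) labels) p lp => ->.
exists (exist (fun A : {set 'I_5} => #|A| == 2) _ card2).
exact: index_uniq petersen_sets_uniq.
Qed.

Lemma petersen_indexing : exists f : petersen -> nat,
  [/\ forall A, f A < 10, injective f,
      forall A B, adj A B = edge petersen_code (f A) (f B) &
      forall i, i < 10 -> exists A, f A = i].
Proof.
exists petersen_index; split.
- exact: petersen_index_small.
- exact: petersen_index_inj.
- exact: petersen_index_adj.
- exact: petersen_index_surj.
Qed.

(** * Components, the clique-cutset and the blowup *)

Lemma connected_components (G : sgraph) (x : G) :
  connected_graph G -> num_components G = 1.
Proof.
move=> conn; have adjC := sym_connect_sym (@adj_sym G).
rewrite -(n_comp_connect adjC x); apply: eq_n_comp_r => y.
by rewrite !inE; apply/esym/conn.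
Qed.

Lemma disconnected_components (G : sgraph) (a : pred G) x y :
  a x -> ~~ a y -> (forall z w, adj z w -> a z -> a w) -> 1 < num_components G.
Proof.
move=> ax nay cl; have adjC := sym_connect_sym (@adj_sym G).
apply/card_gt1P; exists (root adj x), (root adj y).
rewrite !inE !roots_root //; split=> //.
rewrite root_connect //; apply: contra nay => xy.
by have := closed_connect (intro_closed adjC cl) xy; rewrite !unfold_in => <-.
Qed.

Section Attachments.
Variable G : sgraph.
Hypotheses (hP7 : free_of (path_graph 7) G) (hC7 : free_of (cycle_graph 7) G)
  (hC4 : free_of (cycle_graph 4) G) (hgem : free_of gem G).

(** The vertices outside Q that see Q as y does form a union of components of G minus K, which
    misses some vertex of the Petersen graph. *)
Lemma attachment_cutset (x : seq G) y : connected_graph G -> petersen_in x ->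
  ~~ in_star x y -> clique_cutset [set q | in_star x q && adj y q].
Proof.
move=> conn px ny; set K := [set q | _].
split; first exact: (attachment_clique hP7 hC7 hC4 hgem).
rewrite (connected_components y conn).
have yK : y \in ~: K by rewrite !inE (negPf ny).
(* Vertices 0 and 1 of the coded Petersen graph are nonadjacent, so a clique misses one of them. *)
have [i lti ni] : exists2 i, i < 10 & ~~ nth false (trace x y) i.
  have cl := trace_clique hP7 hC7 hC4 hgem px ny.
  have [t0|] := boolP (nth false (trace x y) 0); last by exists 0.
  have [t1|] := boolP (nth false (trace x y) 1); last by exists 1.
  by have := clique_rowP cl (isT : 0 < 10) (isT : 1 < 10) t0 t1 isT.
have sx := petersen_size px.
have star_i : in_star x (nth y x i).
  by apply: in_star_mem => //; rewrite mem_nth ?sx.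
have iK : nth y x i \in ~: K.
  rewrite !inE star_i /=; move: ni.
  by rewrite (@nth_trace _ y) // negb_or => /andP[].
pose attached_like_y (z : induced (~: K)) :=
  ~~ in_star x (sval z) &&
  [forall q, in_star x q ==> (adj (sval z) q == adj y q)].
pose vertex_off_K z zK : induced (~: K) := exist (fun z => z \in ~: K) z zK.
apply: (@disconnected_components _ attached_like_y
  (vertex_off_K y yK) (vertex_off_K _ iK)).
- by rewrite /attached_like_y /= ny; apply/forallP => q; rewrite eqxx implybT.
- by rewrite /attached_like_y /= star_i.
move=> [z zK] [w wK] /(id : _ -> @adj G z w) zw; rewrite /attached_like_y /=.
case/andP=> nz /forallP zy.
(* A neighbor of z in Q is also a neighbor of y, hence in K. *)
have nw : ~~ in_star x w.
  apply/negP => sw; have := zy w; rewrite sw /= zw => /eqP/esym yw.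
  by move: wK; rewrite !inE sw yw.
rewrite nw; apply/forallP => q; apply/implyP => sq.
have := zy q; rewrite sq => /eqP <-.
have wz : adj w z by rewrite adj_sym.
apply/eqP; apply/idP/idP.
  exact: (outside_same_attachment hP7 hC7 hC4 hgem px).
exact: (outside_same_attachment hP7 hC7 hC4 hgem px).
Qed.

Lemma stars_blowup (x : seq G) :
  petersen_in x -> (forall y, in_star x y) -> is_blowup G petersen.
Proof.
move=> px all_star; have [f [small f_inj f_adj f_surj]] := petersen_indexing.
have tr A y : y \in [set y | trace x y == closed_row (f A)] ->
    trace x y = closed_row (f A) by rewrite inE => /eqP.
have same A B y : trace x y = closed_row (f A) ->
    trace x y = closed_row (f B) -> A = B.
  by move=> -> /closed_row_inj eqAB; apply: f_inj; apply: eqAB.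
exists (fun A => [set y | trace x y == closed_row (f A)]); split.
- apply/setP => y; rewrite [RHS]inE; apply/bigcupP.
  have [i /f_surj[A <-] ty] := starsP (all_star y).
  by exists A; rewrite // inE ty.
- move=> A B neAB; rewrite disjoint_subset; apply/subsetP => y /tr tA.
  by rewrite !inE; apply: contra neAB => /eqP tB; rewrite (same A B y).
- move=> A y z /tr ty /tr tz neyz.
  have := star_adj hP7 hC7 hC4 hgem px (small A) (small A) ty tz.
  by rewrite eqxx (negPf neyz).
- move=> A B adjAB y z /tr ty /tr tz.
  have neAB : A != B by apply: contraTneq adjAB => ->; rewrite adj_irrefl.
  have neyz : y != z.
    by apply: contraNneq neAB => eyz; apply/eqP/(same A B y); rewrite // eyz.
  have := star_adj hP7 hC7 hC4 hgem px (small A) (small B) ty tz.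
  by rewrite -f_adj adjAB orbT (negPf neyz).
- move=> A B neAB nadjAB y z /tr ty /tr tz.
  have := star_adj hP7 hC7 hC4 hgem px (small A) (small B) ty tz.
  rewrite -f_adj (negPf nadjAB) orbF.
  rewrite (inj_eq f_inj) (negPf neAB).
  by move/negbT; rewrite negb_or => /andP[].
Qed.
End Attachments.

(** * Decidability of bisimpliciality, and the conclusion *)

Definition cliqueb (G : sgraph) (K : {set G}) :=
  [forall a in K, forall b in K, (a != b) ==> adj a b].

Lemma cliqueP (G : sgraph) (K : {set G}) : reflect (is_clique K) (cliqueb K).
Proof.
apply: (iffP 'forall_in_'forall_in_implyP) => cl a b; first by move=> *; apply: cl.
by move=> aK bK; apply: cl.
Qed.

Definition bisimplicialb (G : sgraph) (v : G) :=
  [exists K1 : {set G}, exists K2 : {set G},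
     [&& cliqueb K1, cliqueb K2 & neighborhood v == K1 :|: K2]].

Lemma bisimplicialP (G : sgraph) (v : G) :
  reflect (bisimplicial v) (bisimplicialb v).
Proof.
apply: (iffP existsP) => -[K1]; last first.
  case=> K2 [/cliqueP c1 /cliqueP c2 /eqP eqN].
  by exists K1; apply/existsP; exists K2; apply/and3P.
by case/existsP=> K2 /and3P[/cliqueP c1 /cliqueP c2 /eqP eqN]; exists K1, K2.
Qed.

Theorem theorem4p5 (G : sgraph)
    (hconn : connected_graph G)
    (hP7 : free_of (path_graph 7) G)
    (hC7 : free_of (cycle_graph 7) G)
    (hC4 : free_of (cycle_graph 4) G)
    (hgem : free_of gem G) :
  (exists K : {set G}, clique_cutset K) \/
  (exists v : G, bisimplicial v) \/
  is_blowup G petersen.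
Proof.
have [/existsP[v /bisimplicialP bv]|/existsPn nob] :=
  boolP [exists v : G, bisimplicialb v]; first by right; left; exists v.
(* The search needs a starting vertex; the empty graph is a blowup with all classes empty. *)
have [v _|G0] := pickP (@predT G); last first.
  have no_vertex (y : G) : False by have := G0 y.
  right; right; exists (fun=> set0); split=> [|A B _|A|A B _|A B _ _];
    by [apply/setP => y; case: (no_vertex y) | apply/pred0P => y; case: (no_vertex y)
       | move=> y; case: (no_vertex y)].
have no_bi (u : G) : ~ bisimplicial u by move/bisimplicialP; apply/negP/nob.
have [x uqx codex] := contains_petersen hP7 hC7 hC4 hgem no_bi v.
have px : petersen_in x by [].
have [/existsP[y ny]|/existsPn all_star] := boolP [exists y, ~~ in_star x y].
  by left; exists [set q | in_star x q && adj y q]; apply: attachment_cutset.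
right; right; apply: (stars_blowup hP7 hC7 hC4 hgem px) => y.
by have := all_star y; rewrite negbK.
Qed.
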